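(* Let $R$ be an atomic domain, let $n\ge 2$ be an integer, and let $T_n(R)$ be the semigroup of upper triangular $n\times n$ matrices over $R$ with nonzero determinant. Then $\mathcal{L}(R)\subseteq\mathcal{L}(T_n(R))$, and equality holds if and only if $\mathcal{L}(R)$ is additively closed.
   Context: A domain is a commutative integral domain with identity; $R$ is atomic if every nonzero non-unit of $R$ is a finite product of irreducible elements (atoms). In a (possibly non-commutative) cancellative semigroup $S$ with identity, an atom is a non-unit that is not a product of two non-units. For a non-unit $a\in S$, $\mathsf{L}(a)\subset\mathbb{N}$ is the set of all $k$ such that $a=u_1\cdots u_k$ with atoms $u_1,\dots,u_k$ of $S$; for a unit $a$, $\mathsf{L}(a)=\{0\}$. The system of sets of lengths is $\mathcal{L}(S)=\{\mathsf{L}(a)\mid a\in S\}$, and $\mathcal{L}(R)$ means $\mathcal{L}(R\setminus\{0\})$, where $R\setminus\{0\}$ is the multiplicative monoid of nonzero elements. For $L,L'\subset\mathbb{Z}$, $L+L'=\{l+l'\mid l\in L,\ l'\in L'\}$. The system $\mathcal{L}(R)$ is additively closed if $L+L'\in\mathcal{L}(R)$ for all $L,L'\in\mathcal{L}(R)$. *)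

(* Defs.v *)
From HB Require Import structures.
From mathcomp Require Import all_boot all_algebra.
From mathcomp Require Import boolp classical_sets.

Set Implicit Arguments.
Unset Strict Implicit.
Unset Printing Implicit Defensive.

Import GRing.Theory.

Local Open Scope classical_set_scope.

Section Factorization.
Variable S : monoidType.

Definition is_unit (a : S) : Prop := exists b : S, (a * b = 1 /\ b * a = 1)%g.

Definition is_atom (a : S) : Prop :=
  ~ is_unit a /\
  ~ exists b c : S, [/\ ~ is_unit b, ~ is_unit c & a = (b * c)%g].

(* The order of the factors matters, since S need not be commutative. *)
Definition atom_product (a : S) (k : nat) : Prop :=
  exists us : seq S,
    [/\ size us = k, forall u, u \in us -> is_atom u & a = (\prod_(u <- us) u)%g].

Definition set_of_lengths (a : S) : set nat :=
  if `[< is_unit a >] then [set 0%N] else [set k | atom_product a k].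

Definition atomic : Prop :=
  forall a : S, ~ is_unit a -> exists k, atom_product a k.

End Factorization.

Definition system_of_lengths (S : monoidType) : set (set nat) :=
  [set L | exists a : S, L = set_of_lengths a].

(* Sets of lengths consist of natural numbers, so sumsets are taken in nat. *)
Definition sumset (L L' : set nat) : set nat :=
  [set (l + l')%N | l in L & l' in L'].

Definition additively_closed (F : set (set nat)) : Prop :=
  forall L L', F L -> F L' -> F (sumset L L').

Local Open Scope ring_scope.

Section NonzeroMonoid.
Variable R : idomainType.

Record nonzero := Nonzero { nonzero_val : R; _ : nonzero_val != 0 }.

HB.instance Definition _ := [isSub for nonzero_val].
HB.instance Definition _ := [Choice of nonzero by <:].

Definition nonzero_one : nonzero := Nonzero (oner_neq0 R).

Fact nonzero_mul_subproof (x y : nonzero) : val x * val y != 0.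
Proof. by rewrite mulf_neq0 ?(valP x) ?(valP y). Qed.

Definition nonzero_mul (x y : nonzero) : nonzero :=
  Nonzero (nonzero_mul_subproof x y).

Fact nonzero_mulA : associative nonzero_mul.
Proof. by move=> x y z; apply/val_inj/mulrA. Qed.

Fact nonzero_mul1 : left_id nonzero_one nonzero_mul.
Proof. by move=> x; apply/val_inj/mul1r. Qed.

Fact nonzero_mulr1 : right_id nonzero_one nonzero_mul.
Proof. by move=> x; apply/val_inj/mulr1. Qed.

HB.instance Definition _ :=
  isMonoid.Build nonzero nonzero_mulA nonzero_mul1 nonzero_mulr1.

End NonzeroMonoid.

Definition atomic_domain (R : idomainType) : Prop := atomic (nonzero R).

Section UpperTriangularMonoid.
Variables (R : idomainType) (n : nat).

(* [is_trig_mx] means lower triangular, hence the transpose. *)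
Definition is_upper_trig_nonsingular : pred 'M[R]_n :=
  fun A => is_trig_mx A^T && (\det A != 0).

Record upper_trig :=
  UpperTrig { upper_trig_val : 'M[R]_n;
              _ : is_upper_trig_nonsingular upper_trig_val }.

HB.instance Definition _ := [isSub for upper_trig_val].
HB.instance Definition _ := [Choice of upper_trig by <:].

Fact upper_trig_one_subproof : is_upper_trig_nonsingular 1%:M.
Proof.
by rewrite /is_upper_trig_nonsingular trmx1 scalar_mx_is_trig det1 oner_neq0.
Qed.

Definition upper_trig_one : upper_trig := UpperTrig upper_trig_one_subproof.

Fact upper_trig_mul_subproof (A B : upper_trig) :
  is_upper_trig_nonsingular (val A *m val B).
Proof.
case: A B => [A /andP[/is_trig_mxP tA dA]] [B /andP[/is_trig_mxP tB dB]] /=.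
apply/andP; split; last by rewrite det_mulmx mulf_neq0.
apply/is_trig_mxP => i j lt_ij; rewrite !mxE big1 // => k _.
have [lt_kj|le_jk] := ltnP k j.
  by have := tA k j lt_kj; rewrite mxE => ->; rewrite mul0r.
have lt_ik : (i < k)%N by apply: leq_trans le_jk.
by have := tB i k lt_ik; rewrite mxE => ->; rewrite mulr0.
Qed.

Definition upper_trig_mul (A B : upper_trig) : upper_trig :=
  UpperTrig (upper_trig_mul_subproof A B).

Fact upper_trig_mulA : associative upper_trig_mul.
Proof. by move=> A B C; apply/val_inj/mulmxA. Qed.

Fact upper_trig_mul1 : left_id upper_trig_one upper_trig_mul.
Proof. by move=> A; apply/val_inj/mul1mx. Qed.

Fact upper_trig_mulr1 : right_id upper_trig_one upper_trig_mul.
Proof. by move=> A; apply/val_inj/mulmx1. Qed.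

HB.instance Definition _ :=
  isMonoid.Build upper_trig upper_trig_mulA upper_trig_mul1 upper_trig_mulr1.

End UpperTriangularMonoid.

(* Main.v *)
(** The diagonal entries are monoid morphisms from T_n(R) to R \ {0}. A matrix
    is a unit iff all its diagonal entries are, and an atom iff one diagonal
    entry is an atom and the others are units: writing A_(P) for the matrix
    whose columns indexed by P are those of A and whose other columns are
    those of the identity, one has A = A_(>= m) A_(< m), so two non-unit
    diagonal entries give a proper factorization. Hence L(A) is the sumset of
    the L(A i i), and L(T_n(R)) consists of the n-fold sumsets of members of
    L(R); the theorem follows since L(1) = {0}. *)

Require Import Defs.
From mathcomp Require Import all_boot all_algebra.
From mathcomp Require Import boolp classical_sets.

Set Implicit Arguments.
Unset Strict Implicit.
Unset Printing Implicit Defensive.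

Import GRing.Theory.

Local Open Scope classical_set_scope.

(** * Factorizations in a monoid, up to units *)

Section FactorizationLengths.
Variable S : monoidType.
Local Open Scope group_scope.

Lemma is_unit1 : is_unit (1 : S).
Proof. by exists 1; rewrite !mulg1. Qed.

Lemma is_unitM (a b : S) : is_unit a -> is_unit b -> is_unit (a * b).
Proof.
move=> [c [ac ca]] [d [bd db]]; exists (d * c); split.
  by rewrite mulgA -(mulgA a) bd mulg1.
by rewrite mulgA -(mulgA d) ca mulg1.
Qed.

Lemma is_unit_mulr (a e : S) : is_unit e -> is_unit (a * e) -> is_unit a.
Proof.
move=> [d [ed de]] uae.
have -> : a = (a * e) * d by rewrite -mulgA ed mulg1.
by apply: is_unitM => //; exists e.
Qed.

Lemma is_unit_mull (a e : S) : is_unit e -> is_unit (e * a) -> is_unit a.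
Proof.
move=> [d [ed de]] uea.
have -> : a = d * (e * a) by rewrite mulgA de mul1g.
by apply: is_unitM => //; exists e.
Qed.

Lemma is_atom_mull (e u : S) : is_unit e -> is_atom u -> is_atom (e * u).
Proof.
move=> ue [nu au]; split; first by move=> /(is_unit_mull ue).
move=> [b [c [nb nc eu]]]; apply: au.
have [d [ed de]] := ue; have ud : is_unit d by exists e.
exists (d * b), c; split => //; first by move=> /(is_unit_mull ud).
by rewrite -mulgA -eu mulgA de mul1g.
Qed.

Lemma is_atom_mulr (e u : S) : is_unit e -> is_atom u -> is_atom (u * e).
Proof.
move=> ue [nu au]; split; first by move=> /(is_unit_mulr ue).
move=> [b [c [nb nc eu]]]; apply: au.
have [d [ed de]] := ue; have ud : is_unit d by exists e.
exists b, (c * d); split => //; first by move=> /(is_unit_mulr ud).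
by rewrite mulgA -eu -mulgA ed mulg1.
Qed.

(* Allowing a unit factor treats units and non-units uniformly. *)
Inductive factors : S -> nat -> Prop :=
| factors_unit e : is_unit e -> factors e 0
| factors_atom u a k : is_atom u -> factors a k -> factors (u * a) k.+1.

Lemma factors_atom1 (u : S) : is_atom u -> factors u 1.
Proof.
move=> au; rewrite -[u]mulg1; apply: factors_atom => //.
exact/factors_unit/is_unit1.
Qed.

(** The unit that ends the factorization of [a] is absorbed by the first atom of [b], or by [b]
    itself when [b] contributes no atom. *)
Lemma factorsM (a b : S) (k l : nat) :
  factors a k -> factors b l -> factors (a * b) (k + l).
Proof.
elim=> {a k} [e ue|u a k au _ IH] fb; last first.
  by rewrite addSn -mulgA; apply: factors_atom => //; apply: IH.
rewrite add0n; case: fb => {b l} [b ub|u b l au fb].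
  by apply: factors_unit; apply: is_unitM.
by rewrite mulgA; apply: factors_atom => //; apply: is_atom_mull.
Qed.

Hypothesis unit_of_mul :
  forall a b : S, is_unit (a * b) -> is_unit a /\ is_unit b.

Lemma factors_of_unit (a : S) (k : nat) : is_unit a -> factors a k -> k = 0.
Proof. by move=> ua fa; case: fa ua => // u b l [nu _] _ /unit_of_mul[]. Qed.

Lemma factors_atom_product (a : S) (k : nat) :
  ~ is_unit a -> factors a k -> atom_product a k.
Proof.
move=> nua fa; elim: fa nua => {a k} [e //|u a k au fa IH] _.
(* A unit tail has length 0 and merges into [u] on the right; a non-unit tail is already a product
   of atoms. *)
have [ua|nua] := pselect (is_unit a).
  exists [:: u * a]; split; last by rewrite big_seq1.
    by rewrite (factors_of_unit ua fa).
  by move=> v; rewrite inE => /eqP ->; apply: is_atom_mulr.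
have [us [<- aus ->]] := IH nua; exists (u :: us).
split; rewrite ?big_cons // => v; rewrite inE => /orP[/eqP -> //|].
exact: aus.
Qed.

Lemma atom_product_factors (a : S) (k : nat) :
  atom_product a k -> factors a k.
Proof.
move=> [us [<- aus ->]] {a k}; elim: us aus => [|u us IH] aus.
  by rewrite big_nil; apply/factors_unit/is_unit1.
rewrite big_cons /=; apply: factors_atom; first by apply: aus; rewrite mem_head.
by apply: IH => v vus; apply: aus; rewrite inE vus orbT.
Qed.

(** By [unit_of_mul] no atom divides a unit, so [factors] gives a unit the single length 0, in
    agreement with the convention for units. *)
Lemma set_of_lengthsE (a : S) : set_of_lengths a = [set k | factors a k].
Proof.
rewrite /set_of_lengths; case: asboolP => ua; apply/seteqP; split=> k /=.
- by move=> ->; apply: factors_unit.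
- exact: factors_of_unit.
- exact: atom_product_factors.
- exact: factors_atom_product.
Qed.

End FactorizationLengths.

(** * Monoid morphisms and iterated sumsets *)

Lemma is_unit_morph (S S' : monoidType) (f : S -> S') :
  f 1%g = 1%g -> (forall a b, f (a * b)%g = (f a * f b)%g) ->
  forall a, is_unit a -> is_unit (f a).
Proof. by move=> f1 fM a [b [ab ba]]; exists (f b); rewrite -!fM ab ba f1. Qed.

Lemma big_sumsetE (n : nat) (F : 'I_n -> set nat) :
  \big[sumset/[set 0%N]]_(i < n) F i =
  [set k | exists2 l : 'I_n -> nat, (forall i, F i (l i)) &
                                    k = (\sum_(i < n) l i)%N].
Proof.
apply/seteqP; split=> k.
  elim: n F k => [|n IH] F k.
    by rewrite big_ord0 => ->; exists (fun=> 0%N); [case|rewrite big_ord0].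
  rewrite big_ord_recl => -[k0 Fk0 [k1 /IH[l Fl ->] <-]].
  (* [unlift ord0 i] is [None] only at [ord0], where the default [k0] is taken. *)
  exists (fun i => oapp l k0 (unlift ord0 i)).
    by move=> i; case: unliftP => [j ->|->].
  rewrite big_ord_recl unlift_none; congr (_ + _)%N.
  by apply: eq_bigr => i _; rewrite liftK.
elim: n F k => [|n IH] F k [l Fl ->]; first by rewrite !big_ord0.
rewrite !big_ord_recl; exists (l ord0) => //.
exists (\sum_(i < n) l (lift ord0 i))%N => //; apply: IH.
by exists (fun i => l (lift ord0 i)).
Qed.

Local Open Scope ring_scope.

(** * The multiplicative monoid of a domain *)

Section Nonzero.
Variable R : idomainType.

Lemma nonzero_mulC (a b : nonzero R) : (a * b = b * a)%g.
Proof. by apply/val_inj/mulrC. Qed.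

Lemma nonzero_unit_of_mul (a b : nonzero R) :
  is_unit (a * b)%g -> is_unit a /\ is_unit b.
Proof.
move=> [c [abc cab]]; split.
  by exists (b * c)%g; rewrite (nonzero_mulC (b * c)%g) mulgA abc.
by exists (c * a)%g; rewrite (nonzero_mulC b) -mulgA cab.
Qed.

Lemma set_of_lengths_nonzero1 : set_of_lengths (1 : nonzero R)%g = [set 0%N].
Proof.
by rewrite /set_of_lengths; case: asboolP => // -[]; apply: is_unit1.
Qed.

End Nonzero.

(** * Diagonals of triangular matrices *)

Section UpperTriangular.
Variables (R : idomainType) (n : nat).
Implicit Types (A B C : upper_trig R n) (i j k : 'I_n) (P Q : pred 'I_n).

Lemma upper_trig_entry0 A i j : (j < i)%N -> val A i j = 0.
Proof.
move=> ji; have /andP[/is_trig_mxP/(_ j i ji)] := valP A.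
by rewrite mxE.
Qed.

Lemma det_upper_trig (M : 'M[R]_n) : is_trig_mx M^T -> \det M = \prod_i M i i.
Proof.
by move=> tM; rewrite -det_tr det_trig //; apply: eq_bigr => i _; rewrite mxE.
Qed.

Lemma upper_trig_diag_neq0 A i : val A i i != 0.
Proof.
have /andP[tA] := valP A; rewrite det_upper_trig // => /prodf_neq0.
exact.
Qed.

Definition diag A i : nonzero R := Nonzero (upper_trig_diag_neq0 A i).

Lemma is_upper_trig_nonsingularP (M : 'M[R]_n) :
  (forall i j, (j < i)%N -> M i j = 0) -> (forall i, M i i != 0) ->
  is_upper_trig_nonsingular M.
Proof.
move=> tM dM; have tM' : is_trig_mx M^T.
  by apply/is_trig_mxP => i j ij; rewrite mxE tM.
by rewrite /is_upper_trig_nonsingular tM' det_upper_trig //; apply/prodf_neq0.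
Qed.

Lemma diag1 i : diag 1%g i = 1%g.
Proof. by apply: val_inj; rewrite /= mxE eqxx. Qed.

Lemma diagM A B i : diag (A * B)%g i = (diag A i * diag B i)%g.
Proof.
apply: val_inj => /=; rewrite mxE (bigD1 i) //= big1 ?addr0 // => k ki.
have [lt_ki|le_ik] := ltnP k i; first by rewrite upper_trig_entry0 ?mul0r.
by rewrite (@upper_trig_entry0 B) ?mulr0 // ltn_neqAle le_ik andbT eq_sym.
Qed.

Lemma diag_unit A i : is_unit A -> is_unit (diag A i).
Proof.
apply: (is_unit_morph (f := fun B => diag B i)); first exact: diag1.
by move=> B C; apply: diagM.
Qed.

(** * Keeping a chosen set of columns *)

Fact cols_subproof P A : is_upper_trig_nonsingular
  (\matrix_(i, j) if P j then val A i j else (i == j)%:R).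
Proof.
apply: is_upper_trig_nonsingularP => [i j ji|i]; rewrite mxE.
  by case: ifP => _; [exact: upper_trig_entry0|rewrite -val_eqE gtn_eqF].
by case: ifP => _; [exact: upper_trig_diag_neq0|rewrite eqxx oner_neq0].
Qed.

Definition cols P A : upper_trig R n := UpperTrig (cols_subproof P A).

Lemma diag_cols P A i : diag (cols P A) i = if P i then diag A i else 1%g.
Proof. by apply: val_inj; rewrite /= mxE eqxx; case: ifP. Qed.

Lemma eq_cols P Q A : P =1 Q -> cols P A = cols Q A.
Proof. by move=> PQ; apply/val_inj/matrixP => i j; rewrite !mxE PQ. Qed.

Lemma cols_cols P Q A : cols P (cols Q A) = cols (predI P Q) A.
Proof.
by apply/val_inj/matrixP => i j; rewrite !mxE /=; case: (P j).
Qed.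

Lemma colsT A : cols predT A = A.
Proof. by apply/val_inj/matrixP => i j; rewrite !mxE. Qed.

Lemma cols0 A : cols pred0 A = 1%g.
Proof. by apply/val_inj/matrixP => i j; rewrite !mxE. Qed.

(* The columns in P are supported on rows in P, where cols (predC P) A acts as
   the identity. *)
Lemma cols_split P A : (forall i j, (i <= j)%N -> P j -> P i) ->
  A = (cols (predC P) A * cols P A)%g.
Proof.
move=> dP; apply/val_inj/matrixP => i j; rewrite !mxE.
have [Pj|Pj] := boolP (P j).
  rewrite (bigD1 i) //= big1 => [|k ki]; rewrite !mxE Pj /=.
    have [_|] := boolP (P i); first by rewrite eqxx mul1r addr0.
    have [|lt_ji] := leqP i j; first by move=> /dP/(_ Pj) ->.
    by rewrite (upper_trig_entry0 _ lt_ji) mulr0 addr0.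
  have [_|] := boolP (P k); first by rewrite eq_sym (negPf ki) mul0r.
  have [|lt_jk] := leqP k j; first by move=> /dP/(_ Pj) ->.
  by rewrite (upper_trig_entry0 _ lt_jk) mulr0.
rewrite (bigD1 j) //= big1 => [|k kj]; rewrite !mxE (negPf Pj) /=.
  by rewrite eqxx mulr1 addr0.
by rewrite (negPf kj) mulr0.
Qed.

(** * Matrices that differ from the identity in one column *)

Fact col_elem_subproof i (a : nonzero R) (x : 'I_n -> R) :
  is_upper_trig_nonsingular
    (\matrix_(k, j) if j == i then
                      if (k < i)%N then x k else val a *+ (k == i)
                    else (k == j)%:R).
Proof.
apply: is_upper_trig_nonsingularP => [k j jk|k]; rewrite mxE.
  case: eqP => [<-|_]; last by rewrite -val_eqE gtn_eqF.
  by rewrite ltnNge (ltnW jk) -val_eqE gtn_eqF.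
case: (eqVneq k i) => [<-|_]; last by rewrite eqxx oner_neq0.
by rewrite ltnn mulr1n; case: a.
Qed.

(** Only the values of [x] before [i] are read, so a full column of a matrix can be passed as
    [x]. *)
Definition col_elem i a x : upper_trig R n :=
  UpperTrig (col_elem_subproof i a x).

Lemma diag_col_elem i a x j :
  diag (col_elem i a x) j = if j == i then a else 1%g.
Proof.
apply: val_inj; rewrite /= mxE; case: eqP => [->|_]; last by rewrite eqxx.
by rewrite ltnn.
Qed.

Lemma cols1E i A : cols (pred1 i) A = col_elem i (diag A i) (val A ^~ i).
Proof.
apply/val_inj/matrixP => k j; rewrite !mxE /=; case: eqP => // ->.
case: ltngtP => [//|ik|/val_inj ->]; last by rewrite eqxx.
by rewrite upper_trig_entry0 // -val_eqE gtn_eqF.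
Qed.

(** With [x = 0] the column [y] survives unchanged: a factorization of the diagonal entry lifts to
    one of the matrix. *)
Lemma col_elemM i a b x y :
  (col_elem i a x * col_elem i b y)%g =
  col_elem i (a * b)%g (fun k => y k + x k * val b).
Proof.
apply/val_inj/matrixP => k j; rewrite !mxE; case: eqVneq => [->|ji].
  rewrite (bigD1 i) //= !mxE eqxx ltnn mulr1n.
  have [lt_ki|le_ik] := ltnP k i.
    have ki : k != i by rewrite neq_ltn lt_ki.
    rewrite (bigD1 k) //= big1 => [|l /andP[li lk]]; rewrite !mxE.
      by rewrite (negPf ki) !eqxx lt_ki mul1r addr0 addrC.
    by rewrite (negPf li) eq_sym (negPf lk) mul0r.
  rewrite big1 => [|l li]; first by rewrite addr0 mulrnAl.
  rewrite !mxE (negPf li) eqxx; case: ltnP => [lt_li|_].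
    by rewrite -val_eqE gtn_eqF ?mul0r // (leq_trans lt_li).
  by rewrite mulr0n mulr0.
rewrite (bigD1 j) //= big1 => [|l lj]; rewrite !mxE (negPf ji).
  by rewrite eqxx mulr1 addr0.
by rewrite (negPf lj) mulr0.
Qed.

Lemma col_elem1 i x : x =1 (fun=> 0) -> col_elem i 1%g x = 1%g.
Proof.
move=> x0; apply/val_inj/matrixP => k j; rewrite !mxE.
case: (eqVneq j i) => // ->; rewrite x0; case: ltnP => [lt_ki|//].
by rewrite -val_eqE ltn_eqF.
Qed.

Lemma col_elem_unit i a x : is_unit a -> is_unit (col_elem i a x).
Proof.
(* The column of the inverse solves [y k + x k * val b = 0], read off from [col_elemM]. *)
move=> [b [ab ba]]; exists (col_elem i b (fun k => - (x k * val b))).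
rewrite !col_elemM ab ba; split; apply: col_elem1 => k; first by rewrite addNr.
rewrite mulNr -mulrA.
by have /(congr1 val) /= -> := ba; rewrite mulr1 subrr.
Qed.

(** [A] is the product of its one-column matrices, taken from the last column to the first. The
    counter [l] adds up along this product, which serves for lengths; units use the constant counter
    0. *)
Lemma upper_trig_ind A (l : 'I_n -> nat) (T : upper_trig R n -> nat -> Prop) :
  T 1%g 0%N ->
  (forall B C (p q : nat), T B p -> T C q -> T (B * C)%g (p + q)%N) ->
  (forall i x, T (col_elem i (diag A i) x) (l i)) ->
  T A (\sum_i l i)%N.
Proof.
move=> T1 TM TE.
have T_prefix m : (m <= n)%N ->
    T (cols (fun j => j < m)%N A) (\sum_(j < n | (j < m)%N) l j)%N.
  elim: m => [|m IH] mn; first by rewrite big_pred0 // (@eq_cols _ pred0) ?cols0.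
  pose i := Ordinal mn.
  (* The columns up to [m] split as column [m] times the columns before it. *)
  rewrite (@cols_split (fun j => j < m)%N (cols _ A)) => [|j k]; last first.
    exact: leq_ltn_trans.
  rewrite !cols_cols (@eq_cols _ (pred1 i)) => [|j]; last first.
    by rewrite /= -val_eqE /= -leqNgt ltnS -eqn_leq eq_sym.
  rewrite cols1E (@eq_cols _ (fun j => j < m)%N) => [|j]; last first.
    by rewrite /= ltnS andb_idr // => /ltnW.
  rewrite (bigD1 i) //=; apply: TM => //.
  rewrite (eq_bigl (fun j : 'I_n => j < m)%N); first exact/IH/ltnW.
  by move=> j; rewrite -val_eqE /= ltnS andbC -ltn_neqAle.
have lt_n : (fun j : 'I_n => j < n)%N =1 predT by move=> j; apply: ltn_ord.
by have := T_prefix n (leqnn n); rewrite (eq_cols _ lt_n) (eq_bigl _ _ lt_n) colsT.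
Qed.

(** * Units, atoms and lengths of triangular matrices *)

Lemma upper_trig_unitP A : is_unit A <-> forall i, is_unit (diag A i).
Proof.
split=> [uA i|uA]; first exact: diag_unit.
apply: (@upper_trig_ind A (fun=> 0%N) (fun B _ => is_unit B)) => [||i x].
- exact: is_unit1.
- by move=> B C _ _; apply: is_unitM.
- exact: col_elem_unit.
Qed.

Lemma upper_trig_unit_of_mul A B :
  is_unit (A * B)%g -> is_unit A /\ is_unit B.
Proof.
move=> /upper_trig_unitP uAB; rewrite !upper_trig_unitP.
by split=> i; have := uAB i; rewrite diagM => /nonzero_unit_of_mul[].
Qed.

(** Away from [i] the diagonals of two factors multiply to 1, so a non-unit factor has its non-unit
    entry at [i]; two such factors would split [u]. *)
Lemma col_elem_atom i u x : is_atom u -> is_atom (col_elem i u x).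
Proof.
move=> [nu au]; split=> [/(diag_unit i)|[B [C [nB nC eBC]]]].
  by rewrite diag_col_elem eqxx.
have dBC j : (diag B j * diag C j)%g = if j == i then u else 1%g.
  by rewrite -diagM -eBC diag_col_elem.
have ud j : j != i -> is_unit (diag B j) /\ is_unit (diag C j).
  move=> ji; apply: nonzero_unit_of_mul.
  by rewrite dBC (negPf ji); apply: is_unit1.
apply: au; exists (diag B i), (diag C i); split; last by rewrite dBC eqxx.
- move=> uB; apply/nB/upper_trig_unitP => j.
  by have [->//|/ud[]] := eqVneq j i.
- move=> uC; apply/nC/upper_trig_unitP => j.
  by have [->//|/ud[]] := eqVneq j i.
Qed.

Lemma atom_split A P : is_atom A -> (forall i j, (i <= j)%N -> P j -> P i) ->
  is_unit (cols (predC P) A) \/ is_unit (cols P A).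
Proof.
move=> [_ aA] dP; apply: contrapT => /not_orP[nu1 nu2]; apply: aA.
by exists (cols (predC P) A), (cols P A); split=> //; apply: cols_split.
Qed.

Lemma diag_atom A : is_atom A ->
  exists i, is_atom (diag A i) /\ forall j, j != i -> is_unit (diag A j).
Proof.
move=> atomA; have [nA aA] := atomA.
have [i nAi] : exists i, ~ is_unit (diag A i).
  by apply/existsNP => uA; apply/nA/upper_trig_unitP.
(* Cutting [A] before column [k] puts the entries at [j] and [k] into different factors, one of
   which is a unit. *)
have two_nonunits j k :
    (j < k)%N -> is_unit (diag A j) \/ is_unit (diag A k).
  move=> jk.
  have [|/(diag_unit k)|/(diag_unit j)] :=
    @atom_split A (fun j => j < k)%N atomA.
  - by move=> ? ?; apply: leq_ltn_trans.
  - by rewrite diag_cols /= ltnn; right.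
  - by rewrite diag_cols /= jk; left.
exists i; split; last first.
  move=> j; rewrite neq_ltn => /orP[ji|ij].
    by have [] := two_nonunits _ _ ji.
  by have [] := two_nonunits _ _ ij.
split=> // -[b [c [nb nc Ai]]]; apply: aA.
pose A_lt := cols (fun j => j < i)%N A.
pose A_gt := cols (fun j => i < j)%N A.
have eA : A = (A_gt * cols (pred1 i) A * A_lt)%g.
  rewrite {1}(@cols_split (fun j => j < i)%N A) => [|? ?]; last first.
    exact: leq_ltn_trans.
  rewrite {1}(@cols_split (fun j => j <= i)%N (cols (predC _) A)) => [|? ?].
    rewrite !cols_cols; congr (_ * _ * _)%g; apply: eq_cols => j /=.
      by rewrite -ltnNge -leqNgt andb_idr // => /ltnW.
    by rewrite -val_eqE -leqNgt -eqn_leq.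
  exact: leq_trans.
(* Column [i] is cut in two: [b] with zeros above it, then [c] carrying the entries of [A] above the
   diagonal. *)
exists (A_gt * col_elem i b (fun=> 0))%g, (col_elem i c (val A ^~ i) * A_lt)%g.
split.
- move=> /(diag_unit i); rewrite diagM diag_col_elem eqxx.
  by move=> /nonzero_unit_of_mul[].
- move=> /(diag_unit i); rewrite diagM diag_col_elem eqxx.
  by move=> /nonzero_unit_of_mul[].
rewrite {1}eA cols1E Ai !mulgA -(mulgA A_gt (col_elem i b _)) col_elemM.
congr (_ * col_elem _ _ _ * _)%g.
by apply/funext => k; rewrite mul0r addr0.
Qed.

Lemma upper_trig_factorsP A (k : nat) :
  factors A k <-> exists2 l : 'I_n -> nat,
    (forall i, factors (diag A i) (l i)) & k = (\sum_i l i)%N.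
Proof.
split=> [|[l fl ->]]; last first.
  apply: upper_trig_ind => [||i x]; first exact/factors_unit/is_unit1.
    exact: factorsM.
  (* Atoms of the diagonal entry are split off one at a time with zeros above them; the last factor,
     a unit, keeps [x]. *)
  elim: (fl i) x => {fl} [e ue|u a m au _ IH] x.
    exact/factors_unit/col_elem_unit.
  have -> : col_elem i (u * a)%g x = (col_elem i u (fun=> 0) * col_elem i a x)%g.
    rewrite col_elemM; congr col_elem.
    by apply/funext => j; rewrite mul0r addr0.
  by apply: factors_atom => //; apply: col_elem_atom.
elim=> {A k} [A uA|U A k /diag_atom[i [ai ui]] _ [l fl ->]].
  exists (fun=> 0%N) => [i|]; first exact/factors_unit/diag_unit.
  by rewrite big1.
(* The atom [U] contributes one atom at position [i] and units elsewhere. *)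
exists (fun j => (j == i) + l j)%N => [j|].
  rewrite diagM; apply: factorsM => //; case: eqVneq => [->|/ui].
    exact: factors_atom1.
  exact: factors_unit.
rewrite big_split -add1n; congr (_ + _)%N.
by rewrite (bigD1 i) //= eqxx big1 // => j /negPf ->.
Qed.

Lemma set_of_lengths_upper_trig A : set_of_lengths A =
  \big[sumset/[set 0%N]]_(i < n) set_of_lengths (diag A i).
Proof.
rewrite (set_of_lengthsE upper_trig_unit_of_mul) big_sumsetE.
apply/seteqP; split=> k /=.
  move=> /upper_trig_factorsP[l fl ->]; exists l => // i.
  by rewrite (set_of_lengthsE (@nonzero_unit_of_mul R)); apply: fl.
move=> [l fl ->]; apply/upper_trig_factorsP; exists l => // i.
by have := fl i; rewrite (set_of_lengthsE (@nonzero_unit_of_mul R)).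
Qed.

End UpperTriangular.

(** * Comparison of the two systems of lengths *)

Lemma sumset0 (L : set nat) : sumset L [set 0%N] = L.
Proof.
apply/seteqP; split=> k; first by move=> [l Ll [_ -> <-]]; rewrite addn0.
by move=> Lk; exists k => //; exists 0%N; rewrite ?addn0.
Qed.

Lemma sumset_upper_trig (R : idomainType) (n : nat) (L L' : set nat) :
  (2 <= n)%N ->
  system_of_lengths (nonzero R) L -> system_of_lengths (nonzero R) L' ->
  system_of_lengths (upper_trig R n) (sumset L L').
Proof.
case: n => [|[|n]] // _ [a ->] [b ->].
pose i0 : 'I_n.+2 := ord0; pose i1 := lift ord0 ord0 : 'I_n.+2.
(* This is the diagonal matrix with entries [a], [b], 1, ..., 1; having two positions uses
   [2 <= n]. *)
exists (col_elem i0 a (fun=> 0) * col_elem i1 b (fun=> 0))%g.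
rewrite set_of_lengths_upper_trig !big_ord_recl !diagM !diag_col_elem /=.
rewrite mulg1 mul1g; congr (sumset _ _).
rewrite (eq_bigr (fun=> [set 0%N])) => [|i _]; last first.
  by rewrite diagM !diag_col_elem /= mulg1 set_of_lengths_nonzero1.
have -> : \big[sumset/[set 0%N]]_(i < n) [set 0%N] = [set 0%N].
  by elim/big_rec: _ => // i _ _ ->; rewrite sumset0.
by rewrite sumset0.
Qed.

Theorem proposition2p2 (R : idomainType) (n : nat)
    (R_atomic : atomic_domain R) (n_ge2 : (2 <= n)%N) :
  system_of_lengths (nonzero R) `<=` system_of_lengths (upper_trig R n) /\
  (system_of_lengths (nonzero R) = system_of_lengths (upper_trig R n) <->
   additively_closed (system_of_lengths (nonzero R))).
Proof.
have L0 : system_of_lengths (nonzero R) [set 0%N].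
  by exists 1%g; rewrite set_of_lengths_nonzero1.
have sub : system_of_lengths (nonzero R) `<=` system_of_lengths (upper_trig R n).
  by move=> L FL; rewrite -[L]sumset0; apply: sumset_upper_trig.
split=> //; split=> [eqF L L' FL FL'|closedF].
  by rewrite eqF; apply: sumset_upper_trig.
apply/seteqP; split=> // _ [A ->]; rewrite set_of_lengths_upper_trig.
(* Closure under sumsets, starting from [[set 0%N]], covers the whole [n]-fold sumset. *)
apply: (big_ind (system_of_lengths (nonzero R))) => // i _.
by exists (diag A i).
Qed.
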